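(* Let $\mathcal C$ be a linear ribbon category (equipped with an m-trace, with respect to which negligibility and strong decomposition are defined as in the context) and let $S\subset\mathrm{Ob}(\mathcal C)$. (1) If all objects in $S$ and all tensor products of objects in $S$ have strong decomposition, then all objects in $\mathcal C^S$ have strong decomposition. (2) Suppose $\mathcal C$ is graded by a commutative group $\mathsf G$ with small symmetric subset $\mathsf X$. If all generic objects in $S$ and all generic tensor products of objects in $S$ have strong decomposition, then all generic objects in $\mathcal C^S$ have strong decomposition.
   Context: A linear ribbon category over a field $\Bbbk$ is a ribbon category with unit $\mathds 1$ whose Hom-sets are $\Bbbk$-vector spaces, with $\Bbbk$-bilinear composition and tensor product, and with $\Bbbk\cong\mathrm{End}(\mathds 1)$ canonically. An object $V$ is simple if $\mathrm{End}(V)=\Bbbk\,\mathrm{Id}_V$; semisimple means a finite direct sum of simple objects. $\mathcal C$ is equipped with an m-trace $\{\mathsf t_V\}_{V\in\mathcal C}$: linear maps $\mathsf t_V:\mathrm{End}(V)\to\Bbbk$ with $\mathsf t_V(fg)=\mathsf t_U(gf)$ for $g:V\to U$, $f:U\to V$, and $\mathsf t_{U\otimes V}(f)=\mathsf t_U(\mathrm{ptr}_V(f))$ for $f\in\mathrm{End}(U\otimes V)$, where $\mathrm{ptr}_V$ is the right partial trace. An object $V$ is negligible if $\mathsf t_V(f)=0$ for all $f\in\mathrm{End}(V)$. A morphism $f:X\to Y$ is negligible if $\mathsf t_X(gf)=0$ for all $g:Y\to X$; $\mathcal C/\mathcal N(\mathcal C)$ is the quotient of $\mathcal C$ by negligible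 morphisms. An object $X$ is weak semisimple if its image in $\mathcal C/\mathcal N(\mathcal C)$ is semisimple. A weak semisimple object $X$ has strong decomposition if $X\cong S_X\oplus N_X$ with $S_X$ semisimple and non-negligible (a possibly zero direct sum of non-negligible simple objects) and $N_X$ negligible. For $S\subset\mathrm{Ob}(\mathcal C)$, $\mathcal C^S$ is the full subcategory of $\mathcal C$ generated by the objects of $S\cup S^*$, $S^*=\{X^*\mid X\in S\}$, under tensor products, direct sums and retracts. A $\mathsf G$-grading on $\mathcal C$ ($\mathsf G$ commutative, additive) is an equivalence $\mathcal C\cong\bigoplus_{g\in\mathsf G}\mathcal C_g$ with full subcategories such that $\mathds 1\in\mathcal C_0$; $V\in\mathcal C_g\Rightarrow V^*\in\mathcal C_{-g}$; $\mathcal C_g\otimes\mathcal C_{g'}\subset\mathcal C_{g+g'}$; and $\mathrm{Hom}(V,V')\neq0$ with $V\in\mathcal C_g$, $V'\in\mathcal C_{g'}$ implies $g=g'$. $\mathsf X\subset\mathsf G$ is symmetric if $\mathsf X=-\mathsf X$, small if no finite union of translates $g_i+\mathsf X$ equals $\mathsf G$. An object is generic if it lies in some $\mathcal C_g$ with $g\in\mathsf G\setminus\mathsf X$.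
   Formalization: The formal version assumes that idempotents split in C, takes the tensor-product hypotheses for products of objects of S and their duals (S ∪ S* ), and in (2) assumes each object of S is homogeneous; without these the statement as printed is false. *)

(* Defs.v *)
From HB Require Import structures.
From mathcomp Require Import all_boot all_algebra.
From mathcomp Require Import boolp.

Set Implicit Arguments.
Unset Strict Implicit.
Unset Printing Implicit Defensive.

Import GRing.Theory.
Local Open Scope ring_scope.
Local Open Scope quotient_scope.

Declare Scope cat_scope.
Delimit Scope cat_scope with cat.
Open Scope cat_scope.

Reserved Notation "g \oc f" (at level 45, right associativity).
Reserved Notation "X \ot Y" (at level 40, left associativity).
Reserved Notation "f \om g" (at level 40, left associativity).

(* Linear categories.  [comp g f] is "g after f". *)
Record lin_cat (k : fieldType) := LinCat {
  obj :> Type;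
  hom : obj -> obj -> lmodType k;
  idm : forall X, hom X X;
  comp : forall X Y Z, hom Y Z -> hom X Y -> hom X Z;
  comp_assoc : forall W X Y Z (h : hom Y Z) (g : hom X Y) (f : hom W X),
    comp h (comp g f) = comp (comp h g) f;
  comp_idl : forall X Y (f : hom X Y), comp (idm Y) f = f;
  comp_idr : forall X Y (f : hom X Y), comp f (idm X) = f;
  comp_linl : forall X Y Z (a : k) (g g' : hom Y Z) (f : hom X Y),
    comp (a *: g + g') f = a *: comp g f + comp g' f;
  comp_linr : forall X Y Z (a : k) (g : hom Y Z) (f f' : hom X Y),
    comp g (a *: f + f') = a *: comp g f + comp g f'
}.

Arguments hom {k l} X Y.
Arguments idm {k l} X.
Arguments comp {k l X Y Z} g f.
Notation "g \oc f" := (comp g f) : cat_scope.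

Section LinearCategories.
Variables (k : fieldType) (C : lin_cat k).

Definition isomorphic (X Y : C) : Prop :=
  exists (f : hom X Y) (g : hom Y X), g \oc f = idm X /\ f \oc g = idm Y.

(* X is a direct sum of the finite family F; for an empty family this says
   that X is a zero object. *)
Definition is_dsum (I : finType) (F : I -> C) (X : C) : Prop :=
  exists (inj : forall i, hom (F i) X) (prj : forall i, hom X (F i)),
    [/\ forall i, prj i \oc inj i = idm (F i),
        forall i j, i != j -> prj j \oc inj i = 0
      & \sum_i (inj i \oc prj i) = idm X].

Definition is_dsum2 (A B X : C) : Prop :=
  is_dsum (fun b : bool => if b then A else B) X.

Definition retract (Y X : C) : Prop :=
  exists (i : hom Y X) (p : hom X Y), p \oc i = idm Y.

Definition idempotents_split : Prop :=
  forall (X : C) (e : hom X X), e \oc e = e ->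
    exists (Y : C) (i : hom Y X) (p : hom X Y),
      p \oc i = idm Y /\ i \oc p = e.

Definition simple (X : C) : Prop :=
  forall f : hom X X, exists a : k, f = a *: idm X.

Definition semisimple (X : C) : Prop :=
  exists (n : nat) (F : 'I_n -> C), (forall i, simple (F i)) /\ is_dsum F X.

End LinearCategories.

Arguments idempotents_split {k} C.

(* Monoidal categories with k-bilinear tensor product and with k = End(1);
   [tensm] is the tensor product of morphisms, [assocV], [lunitV], [runitV]
   are the inverses of the associativity and unit constraints. *)
Record lin_monoidal (k : fieldType) := LinMonoidal {
  mcat :> lin_cat k;
  tens : mcat -> mcat -> mcat;
  unit_obj : mcat;
  tensm : forall X X' Y Y' : mcat,
    hom X X' -> hom Y Y' -> hom (tens X Y) (tens X' Y')
    where "X \ot Y" := (tens X Y) and "f \om g" := (tensm f g);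
  tensm_id : forall X Y, idm X \om idm Y = idm (X \ot Y);
  tensm_comp : forall X X' X'' Y Y' Y''
      (f' : hom X' X'') (f : hom X X') (g' : hom Y' Y'') (g : hom Y Y'),
    (f' \oc f) \om (g' \oc g) = (f' \om g') \oc (f \om g);
  tensm_linl : forall X X' Y Y' (a : k) (f f' : hom X X') (g : hom Y Y'),
    (a *: f + f') \om g = a *: (f \om g) + f' \om g;
  tensm_linr : forall X X' Y Y' (a : k) (f : hom X X') (g g' : hom Y Y'),
    f \om (a *: g + g') = a *: (f \om g) + f \om g';
  assoc : forall X Y Z, hom ((X \ot Y) \ot Z) (X \ot (Y \ot Z));
  assocV : forall X Y Z, hom (X \ot (Y \ot Z)) ((X \ot Y) \ot Z);
  assocK : forall X Y Z, assocV X Y Z \oc assoc X Y Z = idm _;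
  assocVK : forall X Y Z, assoc X Y Z \oc assocV X Y Z = idm _;
  assoc_nat : forall X X' Y Y' Z Z'
      (f : hom X X') (g : hom Y Y') (h : hom Z Z'),
    assoc X' Y' Z' \oc ((f \om g) \om h) = (f \om (g \om h)) \oc assoc X Y Z;
  lunit : forall X, hom (unit_obj \ot X) X;
  lunitV : forall X, hom X (unit_obj \ot X);
  lunitK : forall X, lunitV X \oc lunit X = idm _;
  lunitVK : forall X, lunit X \oc lunitV X = idm _;
  lunit_nat : forall X Y (f : hom X Y),
    lunit Y \oc (idm unit_obj \om f) = f \oc lunit X;
  runit : forall X, hom (X \ot unit_obj) X;
  runitV : forall X, hom X (X \ot unit_obj);
  runitK : forall X, runitV X \oc runit X = idm _;
  runitVK : forall X, runit X \oc runitV X = idm _;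
  runit_nat : forall X Y (f : hom X Y),
    runit Y \oc (f \om idm unit_obj) = f \oc runit X;
  pentagon : forall W X Y Z,
    assoc W X (Y \ot Z) \oc assoc (W \ot X) Y Z =
    (idm W \om assoc X Y Z) \oc assoc W (X \ot Y) Z \oc (assoc W X Y \om idm Z);
  triangle : forall X Y,
    (idm X \om lunit Y) \oc assoc X unit_obj Y = runit X \om idm Y;
  end_unit : bijective (fun a : k => a *: idm unit_obj)
}.

Arguments tens {k l} X Y.
Arguments unit_obj {k} l.
Arguments tensm {k l X X' Y Y'} f g.
Notation "X \ot Y" := (tens X Y) : cat_scope.
Notation "f \om g" := (tensm f g) : cat_scope.

(* Ribbon categories: a braiding, a twist, and a left duality
   ev : X* X -> 1, coev : 1 -> X X*, compatible with the twist. *)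
Record lin_ribbon (k : fieldType) := LinRibbon {
  rcat :> lin_monoidal k;
  braid : forall X Y : rcat, hom (X \ot Y) (Y \ot X);
  braidV : forall X Y : rcat, hom (Y \ot X) (X \ot Y);
  braidK : forall X Y, braidV X Y \oc braid X Y = idm _;
  braidVK : forall X Y, braid X Y \oc braidV X Y = idm _;
  braid_nat : forall (X X' Y Y' : rcat) (f : hom X X') (g : hom Y Y'),
    braid X' Y' \oc (f \om g) = (g \om f) \oc braid X Y;
  hexagon : forall X Y Z : rcat,
    assoc Y Z X \oc braid X (Y \ot Z) \oc assoc X Y Z =
    (idm Y \om braid X Z) \oc assoc Y X Z \oc (braid X Y \om idm Z);
  hexagonV : forall X Y Z : rcat,
    assocV Z X Y \oc braid (X \ot Y) Z \oc assocV X Y Z =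
    (braid X Z \om idm Y) \oc assocV X Z Y \oc (idm X \om braid Y Z);
  twist : forall X : rcat, hom X X;
  twistV : forall X : rcat, hom X X;
  twistK : forall X, twistV X \oc twist X = idm X;
  twistVK : forall X, twist X \oc twistV X = idm X;
  twist_nat : forall (X Y : rcat) (f : hom X Y),
    twist Y \oc f = f \oc twist X;
  twist_tens : forall X Y : rcat,
    twist (X \ot Y) = braid Y X \oc braid X Y \oc (twist X \om twist Y);
  dual : rcat -> rcat;
  ev : forall X : rcat, hom (dual X \ot X) (unit_obj rcat);
  coev : forall X : rcat, hom (unit_obj rcat) (X \ot dual X);
  zigzag : forall X : rcat,
    runit X \oc (idm X \om ev X) \oc assoc X (dual X) X
      \oc (coev X \om idm X) \oc lunitV X = idm X;
  zigzagV : forall X : rcat,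
    lunit (dual X) \oc (ev X \om idm (dual X)) \oc assocV (dual X) X (dual X)
      \oc (idm (dual X) \om coev X) \oc runitV (dual X) = idm (dual X);
  twist_dual : forall X : rcat,
    (twist X \om idm (dual X)) \oc coev X =
    (idm X \om twist (dual X)) \oc coev X
}.

Arguments braid {k l} X Y.
Arguments twist {k l} X.
Arguments dual {k l} X.
Arguments ev {k l} X.
Arguments coev {k l} X.

Section PartialTrace.
Variables (k : fieldType) (C : lin_ribbon k).

(* The right evaluation of the pivotal structure carried by the ribbon
   category. *)
Definition rev (X : C) : hom (X \ot dual X) (unit_obj C) :=
  ev X \oc braid X (dual X) \oc (twist X \om idm (dual X)).

Definition ptr (U V : C) (f : hom (U \ot V) (U \ot V)) : hom U U :=
  runit U \oc (idm U \om rev V) \oc assoc U V (dual V)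
    \oc (f \om idm (dual V))
    \oc assocV U V (dual V) \oc (idm U \om coev V) \oc runitV U.

End PartialTrace.

Record m_trace (k : fieldType) (C : lin_ribbon k) := MTrace {
  mtr :> forall V : C, {scalar (hom V V)};
  mtr_cyc : forall (U V : C) (g : hom V U) (f : hom U V),
    mtr V (f \oc g) = mtr U (g \oc f);
  mtr_ptr : forall (U V : C) (f : hom (U \ot V) (U \ot V)),
    mtr (U \ot V) f = mtr U (ptr f)
}.

Section Negligible.
Variables (k : fieldType) (C : lin_ribbon k) (t : m_trace C).

Definition negligible_obj (V : C) : Prop := forall f : hom V V, t V f = 0.

Definition negligible (X Y : C) (f : hom X Y) : Prop :=
  forall g : hom Y X, t X (g \oc f) = 0.

Definition negl (X Y : C) : {pred hom X Y} := fun f => `[< negligible f >].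

Lemma neglP X Y (f : hom X Y) : reflect (negligible f) (f \in @negl X Y).
Proof. exact: asboolP. Qed.

Lemma comp_0r (X Y Z : C) (g : hom Y Z) : g \oc (0 : hom X Y) = 0.
Proof.
have := comp_linr 1 g (0 : hom X Y) 0; rewrite !scale1r addr0.
by move/eqP; rewrite -subr_eq subrr eq_sym => /eqP.
Qed.

Lemma comp_0l (X Y Z : C) (f : hom X Y) : (0 : hom Y Z) \oc f = 0.
Proof.
have := comp_linl 1 (0 : hom Y Z) 0 f; rewrite !scale1r addr0.
by move/eqP; rewrite -subr_eq subrr eq_sym => /eqP.
Qed.

Lemma negl_submod X Y : submod_closed (@negl X Y).
Proof.
split=> [|a f f' /neglP hf /neglP hf']; apply/neglP => g.
  by rewrite comp_0r linear0.
by rewrite comp_linr linearP hf hf' mulr0 addr0.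
Qed.

HB.instance Definition _ X Y :=
  GRing.isSubmodClosed.Build k (hom X Y) (@negl X Y) (@negl_submod X Y).

Lemma negl_compl (X Y Z : C) (h : hom Y Z) (f : hom X Y) :
  f \in @negl X Y -> h \oc f \in @negl X Z.
Proof. by move=> /neglP hf; apply/neglP => g; rewrite comp_assoc hf. Qed.

Lemma negl_compr (W X Y : C) (f : hom X Y) (h : hom W X) :
  f \in @negl X Y -> f \oc h \in @negl W Y.
Proof.
move=> /neglP hf; apply/neglP => g.
by rewrite comp_assoc mtr_cyc comp_assoc hf.
Qed.

(* The quotient category C / N(C). *)
Definition qhom (X Y : C) : Type := Quotient.quot (@negl X Y).
HB.instance Definition _ X Y := GRing.Zmodule.on (qhom X Y).

Definition qpi (X Y : C) (f : hom X Y) : qhom X Y :=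
  \pi_(Quotient.quot (@negl X Y)) f.
Definition qrepr (X Y : C) (f : qhom X Y) : hom X Y :=
  repr (f : Quotient.quot (@negl X Y)).

Lemma qreprK X Y (f : qhom X Y) : qpi (qrepr f) = f.
Proof. exact: reprK. Qed.

Lemma qpiE X Y (f g : hom X Y) : (qpi f == qpi g) = (f - g \in @negl X Y).
Proof. by rewrite -Quotient.idealrBE. Qed.

Lemma qpiD X Y (f g : hom X Y) : qpi (f + g) = qpi f + qpi g.
Proof. exact: raddfD. Qed.

Definition qscale X Y (a : k) (f : qhom X Y) : qhom X Y := qpi (a *: qrepr f).
Definition qcomp X Y Z (g : qhom Y Z) (f : qhom X Y) : qhom X Z :=
  qpi (qrepr g \oc qrepr f).

Lemma qrepr_pi X Y (f : hom X Y) : qrepr (qpi f) - f \in @negl X Y.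
Proof. by rewrite -qpiE qreprK. Qed.

Lemma qscale_pi X Y (a : k) (f : hom X Y) : qscale a (qpi f) = qpi (a *: f).
Proof. by apply/eqP; rewrite qpiE -scalerBr rpredZ ?qrepr_pi. Qed.

Lemma qcomp_pi X Y Z (g : hom Y Z) (f : hom X Y) :
  qcomp (qpi g) (qpi f) = qpi (g \oc f).
Proof.
apply/eqP; rewrite qpiE; set g' := qrepr _; set f' := qrepr _.
have -> : g' \oc f' - g \oc f = g' \oc (f' - f) + (g' - g) \oc f.
  rewrite [f' - f]addrC [g' - g]addrC -!scaleN1r comp_linr comp_linl !scaleN1r.
  by rewrite [RHS]addrC addrA addrK addrC.
by apply: rpredD; [apply: negl_compl | apply: negl_compr]; apply: qrepr_pi.
Qed.

Lemma qscaleA X Y a b (f : qhom X Y) :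
  qscale a (qscale b f) = qscale (a * b) f.
Proof. by rewrite -[f]qreprK !qscale_pi scalerA. Qed.
Lemma qscale1 X Y : left_id 1 (@qscale X Y).
Proof. by move=> f; rewrite -[f]qreprK qscale_pi scale1r. Qed.
Lemma qscaleDr X Y : right_distributive (@qscale X Y) +%R.
Proof.
move=> a f g; rewrite -[f]qreprK -[g]qreprK -qpiD !qscale_pi.
by rewrite scalerDr qpiD.
Qed.
Lemma qscaleDl X Y (f : qhom X Y) :
  {morph (@qscale X Y)^~ f : a b / a + b}.
Proof. by move=> a b; rewrite -[f]qreprK !qscale_pi scalerDl qpiD. Qed.

HB.instance Definition _ X Y := GRing.Zmodule_isLmodule.Build k (qhom X Y)
  (@qscaleA X Y) (@qscale1 X Y) (@qscaleDr X Y) (@qscaleDl X Y).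

Lemma qpi_lin X Y a (f g : hom X Y) : qpi (a *: f + g) = a *: qpi f + qpi g.
Proof. by rewrite qpiD -[X in X + _]qscale_pi. Qed.

Lemma qcomp_assoc W X Y Z (h : qhom Y Z) (g : qhom X Y) (f : qhom W X) :
  qcomp h (qcomp g f) = qcomp (qcomp h g) f.
Proof.
by rewrite -[f]qreprK -[g]qreprK -[h]qreprK !qcomp_pi comp_assoc.
Qed.
Lemma qcomp_idl X Y (f : qhom X Y) : qcomp (qpi (idm Y)) f = f.
Proof. by rewrite -[f]qreprK qcomp_pi comp_idl. Qed.
Lemma qcomp_idr X Y (f : qhom X Y) : qcomp f (qpi (idm X)) = f.
Proof. by rewrite -[f]qreprK qcomp_pi comp_idr. Qed.
Lemma qcomp_linl X Y Z (a : k) (g g' : qhom Y Z) (f : qhom X Y) :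
  qcomp (a *: g + g') f = a *: qcomp g f + qcomp g' f.
Proof.
by rewrite -[f]qreprK -[g]qreprK -[g']qreprK -qpi_lin !qcomp_pi comp_linl qpi_lin.
Qed.
Lemma qcomp_linr X Y Z (a : k) (g : qhom Y Z) (f f' : qhom X Y) :
  qcomp g (a *: f + f') = a *: qcomp g f + qcomp g f'.
Proof.
by rewrite -[f]qreprK -[g]qreprK -[f']qreprK -qpi_lin !qcomp_pi comp_linr qpi_lin.
Qed.

Definition negl_quot : lin_cat k :=
  @LinCat k C (fun X Y => qhom X Y : lmodType k) (fun X => qpi (idm X)) qcomp
    qcomp_assoc qcomp_idl qcomp_idr qcomp_linl qcomp_linr.

Definition weak_semisimple (X : C) : Prop := semisimple (X : negl_quot).

Definition strong_decomposition (X : C) : Prop :=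
  weak_semisimple X /\
  exists (SX NX : C),
    [/\ is_dsum2 SX NX X,
        exists (n : nat) (F : 'I_n -> C),
          (forall i, simple (F i) /\ ~ negligible_obj (F i)) /\ is_dsum F SX
      & negligible_obj NX].

End Negligible.

Section Generated.
Variables (k : fieldType) (C : lin_ribbon k).

(* The set S u S*. *)
Inductive with_duals (S : C -> Prop) : C -> Prop :=
| with_duals_self X : S X -> with_duals S X
| with_duals_dual X : S X -> with_duals S (dual X).

(* Tensor products, with arbitrary bracketing, of n >= 1 objects of P. *)
Inductive tensor_word (P : C -> Prop) : C -> Prop :=
| word_one X : P X -> tensor_word P X
| word_tens X Y : tensor_word P X -> tensor_word P Y ->
    tensor_word P (X \ot Y).

(* The objects of C^S; the unit and zero objects are included as the empty
   tensor product and the empty direct sum. *)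
Inductive generated (S : C -> Prop) : C -> Prop :=
| gen_base X : with_duals S X -> generated S X
| gen_unit : generated S (unit_obj C)
| gen_tens X Y : generated S X -> generated S Y -> generated S (X \ot Y)
| gen_dsum n (F : 'I_n -> C) X :
    (forall i, generated S (F i)) -> is_dsum F X -> generated S X
| gen_retract X Y : generated S X -> retract Y X -> generated S Y.

(* [D g] is the full subcategory C_g.  The equivalence of C with the direct
   sum of the C_g is [grading_dsum] and [grading_decomp] (the functor sending
   a family of homogeneous objects of distinct degrees to its direct sum is
   defined and essentially surjective) together with [grading_hom] (it is
   fully faithful). *)
Record grading (G : zmodType) (D : G -> C -> Prop) : Prop := Grading {
  grading_dsum : forall n (g : 'I_n -> G) (F : 'I_n -> C),
    injective g -> (forall i, D (g i) (F i)) -> exists X, is_dsum F X;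
  grading_decomp : forall X, exists n (g : 'I_n -> G) (F : 'I_n -> C),
    [/\ injective g, forall i, D (g i) (F i) & is_dsum F X];
  grading_unit : D 0 (unit_obj C);
  grading_dual : forall g V, D g V -> D (- g) (dual V);
  grading_tens : forall g h V W, D g V -> D h W -> D (g + h) (V \ot W);
  grading_hom : forall g h V W, D g V -> D h W ->
    (exists f : hom V W, f != 0) -> g = h
}.

Definition generic (G : zmodType) (D : G -> C -> Prop) (X : G -> Prop)
  (V : C) : Prop := exists2 g, ~ X g & D g V.

End Generated.

Definition symmetric_subset (G : zmodType) (X : G -> Prop) : Prop :=
  forall g, X g <-> X (- g).

Definition small_subset (G : zmodType) (X : G -> Prop) : Prop :=
  forall s : seq G, ~ (forall h, exists2 g, g \in s & X (h - g)).

(* Main.v *)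
(** An object X has strong decomposition iff [idm X] is a sum of morphisms that
factor through simple non-negligible or through negligible objects: a
non-negligible morphism from a simple non-negligible F to X splits, so F can be
cancelled from X together with the corresponding term of the sum.  The objects
X for which [idm X] is a sum of morphisms factoring through a fixed class of
objects are obviously stable under direct sums and retracts, so it suffices to
treat the unit and the tensor words in S and S*, and, in the graded case, the
words of the same degree as X, because the other terms vanish.  A one-letter
word X* is a retract of (X* X) X*. *)

From mathcomp Require Import all_boot all_algebra.
From mathcomp Require Import boolp.
Require Import Defs.

Set Implicit Arguments.
Unset Strict Implicit.
Unset Printing Implicit Defensive.

Import GRing.Theory.
Local Open Scope ring_scope.

(** * Bilinearity of composition, and sums of morphisms factoring through a class of objects *)

Section Composition.
Variables (k : fieldType) (C : lin_cat k).
Implicit Types X Y Z W : C.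

Lemma compDl X Y Z (g g' : hom Y Z) (f : hom X Y) :
  (g + g') \oc f = g \oc f + g' \oc f.
Proof. by have := comp_linl 1 g g' f; rewrite !scale1r. Qed.

Lemma compDr X Y Z (g : hom Y Z) (f f' : hom X Y) :
  g \oc (f + f') = g \oc f + g \oc f'.
Proof. by have := comp_linr 1 g f f'; rewrite !scale1r. Qed.

Lemma comp0m X Y Z (f : hom X Y) : (0 : hom Y Z) \oc f = 0.
Proof. by apply: (addrI ((0 : hom Y Z) \oc f)); rewrite -compDl !addr0. Qed.

Lemma compm0 X Y Z (g : hom Y Z) : g \oc (0 : hom X Y) = 0.
Proof. by apply: (addrI (g \oc (0 : hom X Y))); rewrite -compDr !addr0. Qed.

Lemma compZl X Y Z a (g : hom Y Z) (f : hom X Y) :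
  (a *: g) \oc f = a *: (g \oc f).
Proof. by have := comp_linl a g 0 f; rewrite comp0m !addr0. Qed.

Lemma compZr X Y Z a (g : hom Y Z) (f : hom X Y) :
  g \oc (a *: f) = a *: (g \oc f).
Proof. by have := comp_linr a g f 0; rewrite compm0 !addr0. Qed.

Lemma compBl X Y Z (g g' : hom Y Z) (f : hom X Y) :
  (g - g') \oc f = g \oc f - g' \oc f.
Proof. by rewrite compDl -scaleN1r compZl scaleN1r. Qed.

Lemma compBr X Y Z (g : hom Y Z) (f f' : hom X Y) :
  g \oc (f - f') = g \oc f - g \oc f'.
Proof. by rewrite compDr -scaleN1r compZr scaleN1r. Qed.

Lemma comp_suml (I : finType) X Y Z (g : I -> hom Y Z) (f : hom X Y) :
  (\sum_i g i) \oc f = \sum_i (g i \oc f).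
Proof.
exact: (big_morph (fun g : hom Y Z => g \oc f)
  (fun g g' => compDl g g' f) (comp0m Z f)).
Qed.

Lemma comp_sumr (I : finType) X Y Z (g : hom Y Z) (f : I -> hom X Y) :
  g \oc (\sum_i f i) = \sum_i (g \oc f i).
Proof.
exact: (big_morph (fun f : hom X Y => g \oc f)
  (fun f f' => compDr g f f') (compm0 X g)).
Qed.

(** This is the ideal of morphisms generated by the objects of [P], presented as a list of terms so
    that an induction can treat one factorization at a time. *)
Inductive span_through (P : C -> Prop) X Y : hom X Y -> Prop :=
| span_zero : span_through P 0
| span_add W (a : hom W Y) (b : hom X W) f :
    P W -> span_through P f -> span_through P (a \oc b + f).

Lemma span_comp P X Y W Z (h : hom Y Z) (f : hom X Y) (g : hom W X) :
  span_through P f -> span_through P (h \oc f \oc g).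
Proof.
elim=> [|V a b f' PV _ IH]; first by rewrite comp0m compm0; apply: span_zero.
rewrite compDl compDr -comp_assoc comp_assoc.
exact: span_add.
Qed.

Lemma spanD P X Y (f g : hom X Y) :
  span_through P f -> span_through P g -> span_through P (f + g).
Proof.
move=> Pf Pg; elim: Pf => [|V a b f' PV _ IH]; first by rewrite add0r.
by rewrite -addrA; apply: span_add.
Qed.

Lemma span_sum P X Y (I : finType) (f : I -> hom X Y) :
  (forall i, span_through P (f i)) -> span_through P (\sum_i f i).
Proof.
by move=> Pf; apply: big_ind => [| f1 f2|i _];
  [apply: span_zero | apply: spanD | apply: Pf].
Qed.

Lemma span_id (P : C -> Prop) X : P X -> span_through P (idm X).
Proof.
by move=> PX; rewrite -[idm X]addr0 -(comp_idl (idm X));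
  apply: span_add => //; apply: span_zero.
Qed.

(** Terms with [a = 0] drop out of the sum, so only objects [W] with a nonzero map to [Y] have to be
    handled. In the graded case this removes the words of the wrong degree. *)
Lemma span_trans (P Q : C -> Prop) X Y (f : hom X Y) :
  (forall W (a : hom W Y), P W -> a != 0 -> span_through Q (idm W)) ->
  span_through P f -> span_through Q f.
Proof.
move=> PQ; elim=> [|W a b f' PW _ IH]; first exact: span_zero.
have [->|a0] := eqVneq a 0; first by rewrite comp0m add0r.
apply: spanD => //; rewrite -(comp_idl b); apply: span_comp.
exact: PQ a0.
Qed.

Lemma span_retract P X Y :
  retract Y X -> span_through P (idm X) -> span_through P (idm Y).
Proof.
by move=> [i [p pi]] PX; rewrite -pi -(comp_idl i); apply: span_comp.
Qed.

Lemma span_dsum P (I : finType) (F : I -> C) X : is_dsum F X ->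
  (forall i, span_through P (idm (F i))) -> span_through P (idm X).
Proof.
move=> [inj [prj [_ _ <-]]] PF; apply: span_sum => i.
by rewrite -(comp_idl (prj i)); apply: span_comp.
Qed.

(** Semisimplicity is stated with ordinal indices, while the summands below are indexed by arbitrary
    finite types such as [option I]. *)
Lemma is_dsum_ord (I : finType) (F : I -> C) X :
  is_dsum F X -> is_dsum (fun i : 'I_#|I| => F (enum_val i)) X.
Proof.
move=> [inj [prj [pK p0 s1]]].
exists (fun i => inj (enum_val i)), (fun i => prj (enum_val i)); split=> //.
  by move=> i j ij; apply: p0; rewrite (inj_eq enum_val_inj).
by rewrite -s1 -(big_enum_val (fun i => inj i \oc prj i)).
Qed.

End Composition.

(** * Strong decomposition as a property of the identity morphism *)

Section StrongDecomposition.
Variables (k : fieldType) (C : lin_ribbon k) (t : m_trace C).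
Implicit Types X Y Z W : C.

Definition simple_nonneg X : Prop := simple X /\ ~ negligible_obj t X.

Lemma negl_id X : negligible_obj t X -> idm X \in @negl k C t X X.
Proof. by move=> X0; apply/neglP => g; apply: X0. Qed.

Lemma negl_through X Y W (a : hom W Y) (b : hom X W) :
  negligible_obj t W -> a \oc b \in @negl k C t X Y.
Proof.
by move=> /negl_id W0; rewrite -(comp_idl b); apply/negl_compl/negl_compr.
Qed.

Lemma negl_obj X : idm X \in @negl k C t X X -> negligible_obj t X.
Proof. by move=> /neglP X0 f; rewrite -(comp_idr f); apply: X0. Qed.

(** Some [g] makes the trace of [g \oc a] nonzero. By simplicity this composite is a scalar, which
    is then invertible, and rescaling [g] gives a left inverse. *)
Lemma nonneg_split W Y (a : hom W Y) : simple W -> a \notin @negl k C t W Y ->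
  exists g : hom Y W, g \oc a = idm W.
Proof.
move=> sW /neglP na; have [g ng] : exists g, t W (g \oc a) <> 0.
  by apply: contra_notP na => ng g; apply: contra_notP ng; exists g.
have [c gc] := sW (g \oc a).
have c0 : c != 0.
  by apply: contra_notN ng => /eqP c0; rewrite gc c0 scale0r linear0.
by exists (c^-1 *: g); rewrite compZl gc scalerA mulVf // scale1r.
Qed.

(** The complement of the simple summands appears only as a negligible morphism, not yet as an
    object. This makes it easy to add summands one by one. *)
Definition decomposes X : Prop :=
  exists (I : finType) (F : I -> C)
    (inj : forall i, hom (F i) X) (prj : forall i, hom X (F i)),
  [/\ forall i, simple_nonneg (F i),
      forall i, prj i \oc inj i = idm (F i),
      forall i j, i != j -> prj j \oc inj i = 0
    & idm X - \sum_i (inj i \oc prj i) \in @negl k C t X X].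

(** Here [Y] is the image of the idempotent [idm X - a \oc g]. Since [g \oc u] and [v \oc a] vanish,
    [W] is orthogonal to the summands of [Y], and it takes the index [None]. *)
Lemma decomposes_add W X Y (a : hom W X) (g : hom X W)
    (u : hom Y X) (v : hom X Y) : simple_nonneg W ->
  g \oc a = idm W -> v \oc u = idm Y -> u \oc v = idm X - a \oc g ->
  decomposes Y -> decomposes X.
Proof.
move=> sW ga vu uv [I [F [inj [prj [sF pK p0 neg]]]]].
have gu : g \oc u = 0.
  rewrite -(comp_idr u) -vu [u \oc _]comp_assoc uv compBl comp_idl compBr.
  by rewrite comp_assoc [g \oc (_ \oc _)]comp_assoc ga comp_idl subrr.
have va : v \oc a = 0.
  rewrite -(comp_idl v) -vu -[_ \oc v]comp_assoc uv compBr comp_idr compBl.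
  by rewrite -comp_assoc -[(a \oc g) \oc a]comp_assoc ga comp_idr subrr.
pose F' (o : option I) := if o is Some i then F i else W.
pose inj' (o : option I) : hom (F' o) X :=
  match o with Some i => u \oc inj i | None => a end.
pose prj' (o : option I) : hom X (F' o) :=
  match o with Some i => prj i \oc v | None => g end.
exists (option I), F', inj', prj'; split.
- by case.
- case=> [i|] //=; rewrite -comp_assoc [v \oc _]comp_assoc vu comp_idl.
  exact: pK.
- case=> [i|] [j|] //= ij.
  + by rewrite -comp_assoc [v \oc _]comp_assoc vu comp_idl p0.
  + by rewrite comp_assoc gu comp0m.
  + by rewrite -comp_assoc va compm0.
(* The remainder for [X] is the remainder for [Y] carried along [u] and [v], hence negligible. *)
- have -> : idm X - \sum_o (inj' o \oc prj' o) =
      u \oc (idm Y - \sum_i (inj i \oc prj i)) \oc v; last first.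
    exact/negl_compl/negl_compr.
  rewrite compBl comp_idl compBr uv comp_suml comp_sumr.
  rewrite (bigD1 None) //= opprD addrA; congr (_ - _).
  rewrite (reindex_omap Some id) => [|[]//].
  apply: eq_big => [i|i _]; first by rewrite eqxx.
  by rewrite /= -!comp_assoc.
Qed.

Definition simple_or_negl X : Prop := simple_nonneg X \/ negligible_obj t X.

Hypothesis C_split : idempotents_split C.

(** Induction on the terms of [f]. The object [Y] and the maps [u], [v] stay general because each
    simple object split off replaces [Y] by its complement, while the remaining terms are
    unchanged. *)
Lemma span_decomposes X X' (f : hom X X') : span_through simple_or_negl f ->
  forall Y (u : hom Y X) (v : hom X' Y),
    idm Y - v \oc f \oc u \in @negl k C t Y Y -> decomposes Y.
Proof.
elim=> [|W a b {}f PW _ IH] Y u v.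
  rewrite comp0m compm0 subr0 => Y0.
  (* With no terms left, [idm Y] is itself negligible and the empty family suffices. *)
  exists void, (@of_void C); do 2 exists (fun i : void => match i with end).
  by split; try case; rewrite big_pred0 ?subr0 // => -[].
rewrite compDl compDr opprD addrA addrAC => nY.
(* A negligible term can be moved into the error. *)
have absorb : v \oc (a \oc b) \oc u \in @negl k C t Y Y -> decomposes Y.
  move=> n1; apply: (IH _ u v).
  by have := rpredD nY n1; rewrite subrK.
have [n1|/negP n1] := boolP (v \oc a \in @negl k C t W Y).
  by apply: absorb; rewrite -comp_assoc comp_assoc; apply: negl_compr.
case: PW => [sW|W0]; last first.
  by apply: absorb; rewrite -comp_assoc comp_assoc; apply: negl_through.
have [g ga] := nonneg_split sW.1 (introN idP n1).
move def_w: (v \oc a) ga => w gw.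
(* [W] is now a retract of [Y] via [w] and [g]; the complementary idempotent splits with image
   [Y']. *)
have [|Y' [u' [v' [vu uv]]]] := C_split (e := idm Y - w \oc g).
  rewrite compBl comp_idl compBr comp_idr.
  by rewrite -comp_assoc [g \oc (_ \oc _)]comp_assoc gw comp_idl subrr subr0.
apply: (decomposes_add sW gw vu uv); apply: (IH _ (u \oc u') (v' \oc v)).
(* Since [v'] kills [w], the current term disappears when the identity of [Y] is compressed to
   [Y']. *)
have vw : v' \oc w = 0.
  rewrite -(comp_idl v') -vu -[_ \oc v']comp_assoc uv -comp_assoc.
  by rewrite compBl comp_idl -comp_assoc gw comp_idr subrr compm0.
have -> : idm Y' - (v' \oc v) \oc f \oc (u \oc u') =
    v' \oc (idm Y - v \oc f \oc u - v \oc (a \oc b) \oc u) \oc u'.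
  rewrite !compBl !compBr comp_idl vu -[(v \oc _) \oc u']comp_assoc.
  have -> : v \oc (a \oc b) \oc u = w \oc b \oc u by rewrite -def_w !comp_assoc.
  rewrite [v' \oc (w \oc _) \oc _]comp_assoc [v' \oc (w \oc _)]comp_assoc vw.
  by rewrite !comp0m subr0 -!comp_assoc.
exact/negl_compl/negl_compr.
Qed.

(** The negligible remainder becomes zero in the quotient, and the summands stay simple there
    because every endomorphism in the quotient lifts to [C]. *)
Lemma weak_semisimple_dsum (I : finType) (F : I -> C) X
    (inj : forall i, hom (F i) X) (prj : forall i, hom X (F i)) :
  (forall i, simple (F i)) ->
  (forall i, prj i \oc inj i = idm (F i)) ->
  (forall i j, i != j -> prj j \oc inj i = 0) ->
  idm X - \sum_i (inj i \oc prj i) \in @negl k C t X X ->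
  weak_semisimple t X.
Proof.
move=> sF pK p0 neg; exists #|I|, (fun i => F (enum_val i)); split.
  move=> i f; have [c fc] := sF (enum_val i) (qrepr f).
  by exists c; rewrite -[LHS]qreprK fc -qscale_pi.
have qpi0 Y Z : qpi t (0 : hom Y Z) = 0 :> qhom t Y Z by exact: raddf0.
apply: (@is_dsum_ord k (negl_quot t) I F X).
exists (fun i => qpi t (inj i)), (fun i => qpi t (prj i)); split=> /=.
- by move=> i; rewrite qcomp_pi pK.
- by move=> i j ij; rewrite qcomp_pi p0.
- under eq_bigr do rewrite qcomp_pi.
  rewrite -(big_morph (@qpi k C t X X) (@qpiD k C t X X) (qpi0 X X)).
  by apply/eqP; rewrite eq_sym qpiE.
Qed.

(** The sum [e] of the projections is idempotent; splitting [e] and [idm X - e] yields the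
    semisimple and the negligible summand. *)
Lemma decomposes_strong X : decomposes X -> strong_decomposition t X.
Proof.
move=> [I [F [inj [prj [sF pK p0 neg]]]]]; split.
  by apply: weak_semisimple_dsum p0 neg => // i; case: (sF i).
pose e := \sum_i (inj i \oc prj i).
have einj i : e \oc inj i = inj i.
  rewrite comp_suml (bigD1 i) //= -comp_assoc pK comp_idr big1 ?addr0 // => j ij.
  by rewrite -comp_assoc p0 ?compm0 // eq_sym.
have ee : e \oc e = e.
  rewrite {2}/e comp_sumr; apply: eq_bigr => i _.
  by rewrite comp_assoc einj.
have [SX [u [v [vu uv]]]] := C_split ee.
have [|NX [u' [v' [vu' uv']]]] := C_split (e := idm X - e).
  by rewrite compBl comp_idl compBr comp_idr ee subrr subr0.
exists SX, NX; split.
- exists (fun b : bool => if b return hom (if b then SX else NX) X then u else u').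
  exists (fun b : bool => if b return hom X (if b then SX else NX) then v else v').
  split.
  + by case.
  + case=> [] [] //= _.
    * rewrite -(comp_idr u) -vu [u \oc _]comp_assoc uv -(comp_idl v') -vu'.
      rewrite -[_ \oc v']comp_assoc uv' -comp_assoc [(_ - _) \oc _]comp_assoc.
      by rewrite compBl comp_idl ee subrr comp0m compm0.
    * rewrite -(comp_idr u') -vu' [u' \oc _]comp_assoc uv' -(comp_idl v) -vu.
      rewrite -[_ \oc v]comp_assoc uv -comp_assoc [e \oc _]comp_assoc.
      by rewrite compBr comp_idr ee subrr comp0m compm0.
  + by rewrite big_bool /= uv uv' addrCA subrr addr0.
- exists #|I|, (fun i => F (enum_val i)); split=> [i|]; first exact: sF.
  apply: is_dsum_ord; exists (fun i => v \oc inj i), (fun i => prj i \oc u).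
  split.
  + by move=> i; rewrite -comp_assoc [u \oc _]comp_assoc uv einj.
  + by move=> i j ij; rewrite -comp_assoc [u \oc _]comp_assoc uv einj p0.
  + under eq_bigr do rewrite -comp_assoc [inj _ \oc _]comp_assoc.
    rewrite -comp_sumr -comp_suml -/e -uv.
    by rewrite !comp_assoc vu comp_idl vu.
(* The identity of [NX] factors through the negligible morphism [idm X - e]. *)
- apply: negl_obj; rewrite -(comp_idl (idm NX)) -vu' -comp_assoc.
  by rewrite [u' \oc _]comp_assoc uv'; apply/negl_compl/negl_compr.
Qed.

Lemma strong_span X :
  strong_decomposition t X -> span_through simple_or_negl (idm X).
Proof.
move=> [_ [SX [NX [XSN [n [F [sF SF]]] N0]]]].
apply: (span_dsum XSN); case; last by apply: span_id; right.
by apply: (span_dsum SF) => i; apply: span_id; left.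
Qed.

Lemma span_strong X :
  span_through simple_or_negl (idm X) -> strong_decomposition t X.
Proof.
move=> sX; apply: decomposes_strong.
apply: (span_decomposes sX (u := idm X) (v := idm X)).
by rewrite comp_idr comp_idl subrr rpred0.
Qed.

Lemma strong_retract X Y :
  retract Y X -> strong_decomposition t X -> strong_decomposition t Y.
Proof. by move=> YX /strong_span sX; apply/span_strong/(span_retract YX). Qed.

End StrongDecomposition.

(** * Generated objects, tensor words and their degrees *)

Section TensorWords.
Variables (k : fieldType) (C : lin_ribbon k).
Implicit Types X Y Z W : C.

Lemma tensmDl X X' Y Y' (f f' : hom X X') (g : hom Y Y') :
  (f + f') \om g = f \om g + f' \om g.
Proof. by have := tensm_linl 1 f f' g; rewrite !scale1r. Qed.

Lemma tensmDr X X' Y Y' (f : hom X X') (g g' : hom Y Y') :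
  f \om (g + g') = f \om g + f \om g'.
Proof. by have := tensm_linr 1 f g g'; rewrite !scale1r. Qed.

Lemma tensm0l X X' Y Y' (g : hom Y Y') : (0 : hom X X') \om g = 0.
Proof. by apply: (addrI ((0 : hom X X') \om g)); rewrite -tensmDl !addr0. Qed.

Lemma tensm0r X X' Y Y' (f : hom X X') : f \om (0 : hom Y Y') = 0.
Proof. by apply: (addrI (f \om (0 : hom Y Y'))); rewrite -tensmDr !addr0. Qed.

(** By bilinearity a single pair of terms suffices, and by the interchange law its tensor product
    factors through [V \ot W]. *)
Lemma span_tens (P : C -> Prop) X X' Y Y' (f : hom X X') (g : hom Y Y') :
  (forall V W, P V -> P W -> span_through P (idm (V \ot W))) ->
  span_through P f -> span_through P g -> span_through P (f \om g).
Proof.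
move=> PP Pf Pg; elim: Pf => [|V a b {}f PV _ IHf].
  by rewrite tensm0l; apply: span_zero.
rewrite tensmDl; apply: spanD => // {IHf f}.
elim: Pg => [|W c d {}g PW _ IHg]; first by rewrite tensm0r; apply: span_zero.
rewrite tensmDr; apply: spanD => //.
by rewrite tensm_comp -[b \om d]comp_idl; apply/span_comp/PP.
Qed.

Lemma retract_lunit X : retract (unit_obj C \ot X) X.
Proof. by exists (lunit X), (lunitV X); apply: lunitK. Qed.

Lemma retract_runit X : retract (X \ot unit_obj C) X.
Proof. by exists (runit X), (runitV X); apply: runitK. Qed.

(** The zigzag identity for [dual X], cut after the associator, is a section followed by a
    retraction. This reaches a lone dual letter from a longer word. *)
Lemma retract_dual X : retract (dual X) (dual X \ot X \ot dual X).
Proof.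
exists (assocV (dual X) X (dual X) \oc (idm (dual X) \om coev X)
          \oc runitV (dual X)).
exists (lunit (dual X) \oc (ev X \om idm (dual X))).
by rewrite -[RHS]zigzagV -!comp_assoc.
Qed.

Definition unit_or_word (S : C -> Prop) X : Prop :=
  X = unit_obj C \/ tensor_word (with_duals S) X.

Lemma generated_span S X :
  generated S X -> span_through (unit_or_word S) (idm X).
Proof.
elim=> {X} [X SX||X Y _ IHX _ IHY|n F X _ IHF|X Y _ IHX] //.
- by apply: span_id; right; apply: word_one.
- by apply: span_id; left.
(* A product with a unit factor need not be a word, but it has the other factor as a retract and
   conversely, through the unit constraints. *)
- rewrite -tensm_id; apply: span_tens => // V W [->|wV] wW.
    by apply: (span_retract (retract_lunit W)); apply: span_id.
  case: wW => [->|wW].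
    by apply: (span_retract (retract_runit V)); apply: span_id; right.
  by apply: span_id; right; apply: word_tens.
- by move=> dX; apply: (span_dsum dX).
- by move=> YX; apply: (span_retract YX).
Qed.

Lemma unit_simple : simple (unit_obj C).
Proof.
by move=> f; have [g _ gK] := end_unit C; exists (g f); rewrite gK.
Qed.

Lemma word_homogeneous (G : zmodType) (D : G -> C -> Prop) (S : C -> Prop) W :
  grading D -> (forall V, S V -> exists g, D g V) ->
  tensor_word (with_duals S) W -> exists g, D g W.
Proof.
move=> gD SD; elim=> {W} [_ [X /SD[g Dg]|X /SD[g Dg]]|X Y _ [g Dg] _ [h Dh]].
- by exists g.
- by exists (- g); apply: grading_dual gD _ _ Dg.
- by exists (g + h); apply: grading_tens gD _ _ _ _ Dg Dh.
Qed.

End TensorWords.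

Theorem theorem1p6 (k : fieldType) (C : lin_ribbon k) (t : m_trace C)
    (C_split : idempotents_split C) (S : C -> Prop) :
  ((forall X, S X -> strong_decomposition t X) ->
   (forall X Y, tensor_word (with_duals S) X -> tensor_word (with_duals S) Y ->
      strong_decomposition t (X \ot Y)) ->
   forall X, generated S X -> strong_decomposition t X)
  /\
  (forall (G : zmodType) (D : G -> C -> Prop) (X : G -> Prop),
   grading D -> small_subset X -> symmetric_subset X ->
   (forall V, S V -> exists g, D g V) ->
   (forall V, S V -> generic D X V -> strong_decomposition t V) ->
   (forall V W, tensor_word (with_duals S) V -> tensor_word (with_duals S) W ->
      generic D X (V \ot W) -> strong_decomposition t (V \ot W)) ->
   forall V, generated S V -> generic D X V -> strong_decomposition t V).
Proof.
(* The unit is simple, so it belongs to the class whether its trace vanishes or not. *)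
have C1 : span_through (simple_or_negl t) (idm (unit_obj C)).
  apply: span_id; have [N1|N1] := EM (negligible_obj t (unit_obj C)).
    by right.
  by left; split=> //; apply: unit_simple.
split=> [HS HT X /generated_span gX|G D X gD _ _ SD HS HT V /generated_span gV].
  apply: (span_strong C_split); apply: span_trans gX => W a [W1|wW] _;
    first by rewrite W1.
  apply: strong_span; case: wW => [_ [Y /HS //|Y SY]|Y Z wY wZ]; last exact: HT.
  apply: (strong_retract C_split (retract_dual Y)); apply: HT.
    by apply: word_tens; apply: word_one; [right | left].
  by apply: word_one; right.
move=> [g nXg Dg].
apply: (span_strong C_split); apply: span_trans gV => W a [W1|wW] a0;
  first by rewrite W1.
(* The nonzero map [a] from the homogeneous word [W] to [V] forces equal degrees, so [W] is generic
   too. *)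
have {a a0} DW : D g W.
  have [h Dh] := word_homogeneous gD SD wW.
  by rewrite -(grading_hom gD Dh Dg) //; exists a.
apply: strong_span; case: wW DW => [_ [Y SY|Y SY]|Y Z wY wZ] DW.
- by apply: HS => //; exists g.
- apply: (strong_retract C_split (retract_dual Y)); apply: HT.
  + by apply: word_tens; apply: word_one; [right | left].
  + by apply: word_one; right.
  (* The longer word has degree [(- h + h) + g = g], so it is still generic. *)
  + have [h Dh] := SD _ SY; exists g => //.
    rewrite -[g]add0r -(addNr h); apply: (grading_tens gD) DW.
    by apply: (grading_tens gD) => //; apply: (grading_dual gD).
- by apply: HT => //; exists g.
Qed.
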